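(* Let $\bar F$ be the resonant projection of a vector field $F$ on $X=\mathbb C\times\mathbb S^1\times\mathbb R$ with finite Fourier--Taylor expansion, and let $L_0(z,\psi,w)=(i\omega_0z,\Omega_0,0)$. Then the truncated first-order normal form $$\dot u=\mathcal F(u)=L_0(u)+\varepsilon\,\bar F(u)$$ is $R_\theta$-equivariant, i.e. $DR_\theta(u)\,\mathcal F(u)=\mathcal F(R_\theta(u))$ for all $u\in X$ and all $\theta\in\mathbb R$, where $R_\theta(z,\psi,w)=(e^{i\omega_0\theta}z,\ \psi+\Omega_0\theta,\ w)$.
   Context: Here $\omega_0>0$, $\Omega_0\neq0$ are constants with $\omega_0/\Omega_0\in\mathbb Q$, and $0<\varepsilon\ll1$. Vector fields on $X=\mathbb C\times\mathbb S^1\times\mathbb R$ ($\mathbb S^1=\mathbb R/2\pi\mathbb Z$) are written in components $F=(F_z,F_\psi,F_w)$, with $F_z$ complex-valued and $F_\psi,F_w$ real-valued. The derivative $DR_\theta(u)$ acts on tangent vectors by $(V_z,V_\psi,V_w)\mapsto(e^{i\omega_0\theta}V_z,V_\psi,V_w)$. Let $\mathcal A=\mathbb N_0\times\mathbb N_0\times\mathbb Z\times\mathbb N_0$ and, for $\alpha=(a,b,k,c)\in\mathcal A$, $M_\alpha(z,\psi,w)=z^a\bar z^be^{ik\psi}w^c$. The field $F$ has a finite Fourier--Taylor expansion if $F_j=\sum_{\alpha\in\mathcal A}f_j^\alpha M_\alpha$ with only finitely many nonzero $f_j^\alpha\in\mathbb C$, $j\in\{z,\psi,w\}$ (real-valuedness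 gives $f_j^{(b,a,-k,c)}=\overline{f_j^{(a,b,k,c)}}$ for $j\in\{\psi,w\}$). Put $\lambda_\alpha^{(z)}=(a-b-1)\omega_0+k\Omega_0$, $\lambda_\alpha^{(\psi)}=\lambda_\alpha^{(w)}=(a-b)\omega_0+k\Omega_0$, and $\Lambda_j^{\mathcal R}=\{\alpha\in\mathcal A:\lambda_\alpha^{(j)}=0\}$. The resonant projection $\bar F$ of $F$ is $\bar F_j=\sum_{\alpha\in\Lambda_j^{\mathcal R}}f_j^\alpha M_\alpha$. *)

(* Defs.v *)
From HB Require Import structures.
From mathcomp Require Import all_boot all_order all_algebra.
From mathcomp Require Import finmap generic_quotient ring_quotient complex.
From mathcomp Require Import all_classical all_reals all_analysis.
From mathcomp Require Import ring.

Set Implicit Arguments.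
Unset Strict Implicit.
Unset Printing Implicit Defensive.

Import Order.TTheory GRing.Theory Num.Theory.

Local Open Scope ring_scope.
Local Open Scope complex_scope.
Local Open Scope quotient_scope.

Section Circle.
Variable R : realType.

Definition two_pi_Z : {pred R} := fun x => x / (pi *+ 2) \is a Num.int.

Fact two_pi_Z_zmod_closed : zmod_closed two_pi_Z.
Proof.
split=> [|x y].
  by rewrite unfold_in /two_pi_Z mul0r rpred0.
by rewrite !unfold_in /two_pi_Z mulrBl; exact: rpredB.
Qed.

HB.instance Definition _ := GRing.isZmodClosed.Build R two_pi_Z
  two_pi_Z_zmod_closed.

(* R / 2 pi Z, with its quotient group structure *)
Definition circle := Quotient.quot two_pi_Z.

Definition to_circle (x : R) : circle := \pi_(Quotient.quot two_pi_Z) x.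

Definition expi (t : R) : R[i] := cos t +i* sin t.

(* e^{ik psi}; independent of the representative of psi by [ecircE] below *)
Definition ecirc (k : int) (psi : circle) : R[i] :=
  expi (k%:~R * repr (psi : Quotient.quot two_pi_Z)).

Lemma expi0 : expi 0 = 1.
Proof. by rewrite /expi cos0 sin0. Qed.

Lemma expiD s t : expi (s + t) = expi s * expi t.
Proof.
rewrite /expi cosD sinD; apply/eqP; rewrite eq_complex /=.
by apply/andP; split; apply/eqP => //; rewrite addrC.
Qed.

Lemma expiN t : expi (- t) = (expi t)^*.
Proof. by rewrite /expi cosN sinN. Qed.

Lemma expi_pi : expi pi = - 1.
Proof.
rewrite /expi cospi sinpi.
by apply/eqP; rewrite eq_complex /= oppr0 !eqxx. Qed.

Lemma expi_2pi (n : int) : expi (n%:~R * (pi *+ 2)) = 1.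
Proof.
have hnat (m : nat) : expi (m%:R * (pi *+ 2)) = 1.
  elim: m => [|m IHm]; first by rewrite mul0r expi0.
  rewrite -natr1 mulrDl mul1r expiD IHm mul1r mulr2n expiD expi_pi.
  by rewrite mulrNN mulr1.
case: n => m; first exact: hnat.
by rewrite NegzE mulrNz mulNr expiN hnat conjc1.
Qed.

Lemma ecircE k x : ecirc k (to_circle x) = expi (k%:~R * x).
Proof.
rewrite /ecirc /to_circle.
set y := repr _.
have : x - y \in two_pi_Z.
  by rewrite Quotient.idealrBE /y reprK.
rewrite unfold_in => /intrP[n hn].
have pi2 : (pi *+ 2 : R) != 0 by rewrite mulrn_eq0 /= gt_eqF ?pi_gt0.
have -> : x = y + n%:~R * (pi *+ 2) by rewrite -hn divfK // addrC subrK.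
by rewrite mulrDr expiD mulrA -intrM expi_2pi mulr1.
Qed.

Lemma to_circleD : {morph to_circle : x y / x + y}.
Proof. by move=> x y; exact: raddfD. Qed.

Lemma to_circleK psi : to_circle (repr (psi : Quotient.quot two_pi_Z)) = psi.
Proof. exact: reprK. Qed.

Lemma ecircD k psi x :
  ecirc k (psi + to_circle x) = ecirc k psi * expi (k%:~R * x).
Proof. by rewrite -(to_circleK psi) -to_circleD !ecircE mulrDr expiD. Qed.

Lemma resonant_sum_eq0 (s : seq (R * R[i])) :
  (forall theta, \sum_(p <- s) p.2 * expi (p.1 * theta) = 0) ->
  \sum_(p <- s | p.1 == 0) p.2 = 0.
Proof.
have [m] := ubnP (size s); elim: m s => // m IHm s /ltnSE sm hs.
have [/hasP[p0 p0s p0N]|] := boolP (has (fun p => p.1 != 0) s); last first.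
  rewrite -all_predC => /allP s0.
  rewrite -[RHS](hs 0) big_seq_cond [RHS]big_seq.
  apply: eq_big => [p|p /andP[ps _]].
    by case: (boolP (p \in s)) => //= /s0 /=; rewrite negbK.
  by rewrite mulr0 expi0 mulr1.
pose h := pi / p0.1.
pose g (p : R * R[i]) := (p.1, p.2 * (expi (p.1 * h) - expi (p0.1 * h))).
pose s' := [seq g p | p <- s & p.1 != p0.1].
have s'm : (size s' < m)%N.
  apply: leq_trans sm; rewrite size_map size_filter.
  rewrite -(count_predC (fun p => p.1 != p0.1) s) -[ltnLHS]addn0 ltn_add2l.
  by rewrite -has_count; apply/hasP; exists p0 => //=; rewrite eqxx.
have hs' theta : \sum_(p <- s') p.2 * expi (p.1 * theta) = 0.
  rewrite big_map big_filter.
  transitivity (\sum_(p <- s) (g p).2 * expi (p.1 * theta)).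
    rewrite [RHS](bigID (fun p => p.1 != p0.1)) /= [X in _ + X]big1 ?addr0 //.
    by move=> p; rewrite negbK => /eqP ->; rewrite subrr mulr0 mul0r.
  transitivity (\sum_(p <- s) p.2 * expi (p.1 * (theta + h)) -
     expi (p0.1 * h) * \sum_(p <- s) p.2 * expi (p.1 * theta)).
    rewrite mulr_sumr -sumrB; apply: eq_bigr => p _ /=.
    by rewrite (mulrDr p.1) expiD; ring.
  by rewrite !hs mulr0 subrr.
have := IHm _ s'm hs'; rewrite big_map big_filter_cond /=.
have -> : p0.1 * h = pi by rewrite /h mulrC divfK.
rewrite (eq_bigr (fun p => p.2 * 2)); last first.
  by move=> p /andP[_ /eqP ->]; rewrite mul0r expi0 expi_pi opprK.
rewrite -mulr_suml => /eqP; rewrite mulf_eq0 pnatr_eq0 orbF => /eqP e.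
rewrite -[RHS]e; apply: eq_bigl => p /=.
by case: eqP => [->|]; rewrite ?andbF // andbT eq_sym p0N.
Qed.

End Circle.

Definition phase_space (R : realType) : Type := (R[i] * circle R * R)%type.

(* components (V_z, V_psi, V_w) of a tangent vector *)
Definition tangent (R : realType) : zmodType := (R[i] * R * R)%type.

Definition multi_index : Type := (nat * nat * int * nat)%type.

Variant component := Comp_z | Comp_psi | Comp_w.

Section Fields.
Variable R : realType.

Definition vector_field := phase_space R -> tangent R.

Definition tcomp (j : component) (V : tangent R) : R[i] :=
  match j with
  | Comp_z => V.1.1
  | Comp_psi => V.1.2%:C
  | Comp_w => V.2%:C
  end.

Definition tscale (r : R) (V : tangent R) : tangent R :=
  let: (Vz, Vpsi, Vw) := V in (r%:C * Vz, r * Vpsi, r * Vw).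

Definition monomial (alpha : multi_index) (u : phase_space R) : R[i] :=
  let: (a, b, k, c) := alpha in
  let: (z, psi, w) := u in
  z ^+ a * z^*%C ^+ b * ecirc k psi * w%:C ^+ c.

(* [f j alpha] is the coefficient f_j^alpha *)
Definition ft_coefficients := component -> {fsfun multi_index -> R[i] with 0}.

Definition ft_expansion (F : vector_field) (f : ft_coefficients) : Prop :=
  forall j u,
    tcomp j (F u) = \sum_(alpha <- finsupp (f j)) f j alpha * monomial alpha u.

Definition has_finite_ft_expansion (F : vector_field) : Prop :=
  exists f, ft_expansion F f.

Variables omega0 Omega0 : R.

Definition lambda (j : component) (alpha : multi_index) : R :=
  let: (a, b, k, _) := alpha in
  match j with
  | Comp_z => (a%:R - b%:R - 1) * omega0 + k%:~R * Omega0
  | Comp_psi | Comp_w => (a%:R - b%:R) * omega0 + k%:~R * Omega0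
  end.

Definition resonant (j : component) : pred multi_index :=
  fun alpha => lambda j alpha == 0.

(* A relation, because Fbar takes its values in C x R x R and the psi- and
   w-sums have to be recognized as real numbers; it is the graph of a function
   on the fields with a finite expansion, by [resonant_projection_exists] and
   [resonant_projection_unique] below. *)
Definition resonant_projection (F Fbar : vector_field) : Prop :=
  exists2 f, ft_expansion F f &
    forall j u, tcomp j (Fbar u) =
      \sum_(alpha <- finsupp (f j) | resonant j alpha)
        f j alpha * monomial alpha u.

Definition L0 : vector_field :=
  fun u => let: (z, psi, w) := u in ('i%C * omega0%:C * z, Omega0, 0).

Definition normal_form (eps : R) (Fbar : vector_field) : vector_field :=
  fun u => L0 u + tscale eps (Fbar u).

Definition Rot (theta : R) (u : phase_space R) : phase_space R :=
  let: (z, psi, w) := u in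
  (expi (omega0 * theta) * z, psi + to_circle (Omega0 * theta), w).

(* the derivative of [Rot theta] at [u] *)
Definition DRot (theta : R) (u : phase_space R) (V : tangent R) : tangent R :=
  let: (Vz, Vpsi, Vw) := V in (expi (omega0 * theta) * Vz, Vpsi, Vw).

Definition Rot_equivariant (F : vector_field) : Prop :=
  forall u theta, DRot theta u (F u) = F (Rot theta u).

Lemma monomial_Rot alpha theta u :
  monomial alpha (Rot theta u) =
  expi (lambda Comp_w alpha * theta) * monomial alpha u.
Proof.
case: alpha => [[[a b] k] c]; case: u => [[z psi] w] /=.
have X t n : expi t ^+ n = expi (n%:R * t) :> R[i].
  elim: n => [|n IHn]; first by rewrite mul0r expi0.
  by rewrite exprS IHn -expiD -natr1 mulrDl mul1r addrC.
have -> : conjc (expi (omega0 * theta) * z) =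
    expi (- (omega0 * theta)) * conjc z.
  by rewrite expiN; exact: (rmorphM (@conjc R)).
rewrite ecircD !exprMn !X.
have -> : ((a%:R - b%:R) * omega0 + k%:~R * Omega0) * theta =
   a%:R * (omega0 * theta) + b%:R * - (omega0 * theta) +
    k%:~R * (Omega0 * theta).
  by rewrite mulrDl mulrBl mulrBl mulrN !mulrA.
rewrite !expiD.
by ring.
Qed.

Let shift (j : component) : R := if j is Comp_z then omega0 else 0.

Lemma ft_expansion_Rot F f j theta u : ft_expansion F f ->
  \sum_(alpha <- finsupp (f j))
     f j alpha * monomial alpha u * expi (lambda j alpha * theta) =
  expi (- (shift j * theta)) * tcomp j (F (Rot theta u)).
Proof.
move=> /(_ j) ->; rewrite mulr_sumr; apply: eq_bigr => alpha _.
rewrite monomial_Rot.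
have -> : lambda j alpha * theta =
    - (shift j * theta) + lambda Comp_w alpha * theta.
  by case: alpha => [[[a b] k] c]; case: j => /=; ring.
by rewrite expiD; ring.
Qed.

Lemma resonant_sum_real F f j u : ft_expansion F f -> j <> Comp_z ->
  let S : R[i] := \sum_(alpha <- finsupp (f j) | resonant j alpha)
             f j alpha * monomial alpha u in
  (complex.Re S)%:C = S.
Proof.
move=> Ff jz S; set fM := fun alpha => f j alpha * monomial alpha u in S *.
have shift0 : shift j = 0 by move: jz; rewrite /shift; case: (j).
pose s := [seq (lambda j alpha, fM alpha) | alpha <- finsupp (f j)] ++
  [seq (- lambda j alpha, - conjc (fM alpha)) | alpha <- finsupp (f j)].
have hs theta : \sum_(p <- s) p.2 * expi (p.1 * theta) = 0.
  rewrite big_cat !big_map /=.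
  set T := \sum_(alpha <- _) _.
  have -> : \sum_(alpha <- finsupp (f j))
      - conjc (fM alpha) * expi (- lambda j alpha * theta) = - conjc T.
    rewrite /T (raddf_sum (@conjc R)) /= -sumrN; apply: eq_bigr => alpha _.
    by rewrite mulNr mulNr expiN -(rmorphM (@conjc R)).
  have -> : T = tcomp j (F (Rot theta u)).
    by rewrite /T (ft_expansion_Rot _ _ _ Ff) shift0 mul0r oppr0 expi0 mul1r.
  by move: (F _) jz => V; case: (j) => //= _; rewrite ?conjc_real oppr0 subrr.
have := resonant_sum_eq0 hs; rewrite big_cat !big_map /=.
rewrite [X in _ + X](eq_bigl (resonant j)); last first.
  by move=> alpha; rewrite oppr_eq0.
rewrite sumrN -(raddf_sum (@conjc R)) /= -/S => /eqP; rewrite subr_eq0.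
case: S => x y /eqP[] /eqP; rewrite -addr_eq0 -mulr2n mulrn_eq0 /= => /eqP ->.
by [].
Qed.

Lemma resonant_projection_exists F :
  has_finite_ft_expansion F -> exists Fbar, resonant_projection F Fbar.
Proof.
case=> f Ff.
pose S j u : R[i] := \sum_(alpha <- finsupp (f j) | resonant j alpha)
                f j alpha * monomial alpha u.
exists (fun u =>
  (S Comp_z u, complex.Re (S Comp_psi u), complex.Re (S Comp_w u))).
by exists f => // -[] u //=; exact: resonant_sum_real.
Qed.

Lemma resonant_projection_unique F Fbar1 Fbar2 :
  resonant_projection F Fbar1 -> resonant_projection F Fbar2 ->
  Fbar1 =1 Fbar2.
Proof.
move=> [f Ff F1] [g Fg F2] u.
have e j : tcomp j (Fbar1 u) = tcomp j (Fbar2 u).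
  apply/eqP; rewrite -subr_eq0 F1 F2; apply/eqP.
  pose s := [seq (lambda j a, f j a * monomial a u) | a <- finsupp (f j)] ++
    [seq (lambda j a, - (g j a * monomial a u)) | a <- finsupp (g j)].
  have hs theta : \sum_(p <- s) p.2 * expi (p.1 * theta) = 0.
    rewrite big_cat !big_map /= (ft_expansion_Rot _ _ _ Ff).
    rewrite -(ft_expansion_Rot _ _ _ Fg) -big_split /=.
    by rewrite big1 // => alpha _; rewrite mulNr subrr.
  by have := resonant_sum_eq0 hs; rewrite big_cat !big_map /= sumrN.
move: (e Comp_z) (e Comp_psi) (e Comp_w).
case: (Fbar1 u) (Fbar2 u) => [[a b] c] [[a' b'] c'] /= -> + +.
by move=> [->] [->].
Qed.

End Fields.

(* Main.v *)
(** Under the rotation [R_theta] a monomial [M_alpha] is multiplied by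
    [e^(i lambda_alpha^(w) theta)].  For a [j]-resonant [alpha] this factor is
    the one by which [DR_theta] acts on the [j]-th component: [e^(i omega0 theta)]
    for [j = z] and [1] otherwise.  So the resonant projection is equivariant
    term by term, and [L0] is the generator of the rotations themselves. *)
Require Import Defs.
From mathcomp Require Import all_boot all_order all_algebra.
From mathcomp Require Import complex.
From mathcomp Require Import all_classical all_reals all_analysis.
From mathcomp Require Import ring.
Import Order.TTheory GRing.Theory Num.Theory.
Local Open Scope ring_scope.

(** The frequency at which [DRot] rotates the [j]-th component. *)
Definition DRot_weight {R : realType} (omega0 : R) (j : component) : R :=
  if j is Comp_z then omega0 else 0.

(** Lets the complex component and the two real ones be treated uniformly, as complex sums. *)
Lemma tcomp_inj (R : realType) (V W : tangent R) :
  (forall j, tcomp j V = tcomp j W) -> V = W.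
Proof.
move=> e; move: (e Comp_z) (e Comp_psi) (e Comp_w) => {e}.
by case: V W => [[a b] c] [[a' b'] c'] /= -> [->] [->].
Qed.

Lemma tcomp_DRot (R : realType) (omega0 theta : R) u V j :
  tcomp j (DRot omega0 theta u V) =
  expi (DRot_weight omega0 j * theta) * tcomp j V.
Proof. by case: V j => [[a b] c] [] //=; rewrite mul0r expi0 mul1r. Qed.

Lemma resonant_monomial_Rot (R : realType) (omega0 Omega0 theta : R) j alpha u :
  resonant omega0 Omega0 j alpha ->
  monomial alpha (Rot omega0 Omega0 theta u) =
  expi (DRot_weight omega0 j * theta) * monomial alpha u.
Proof.
move=> /eqP res; rewrite monomial_Rot.
suff -> : DRot_weight omega0 j = lambda omega0 Omega0 Comp_w alpha by [].
(* Adding the vanishing [lambda j alpha] to the weight leaves an identity that holds for every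
   [alpha]. *)
rewrite -[LHS]addr0 -res.
by case: alpha {res} => [[[a b] k] c]; case: j => /=; ring.
Qed.

Lemma resonant_projection_Rot_equivariant (R : realType) (omega0 Omega0 : R)
    (F Fbar : vector_field R) :
  resonant_projection omega0 Omega0 F Fbar ->
  Rot_equivariant omega0 Omega0 Fbar.
Proof.
move=> [f _ FbarE] u theta; apply: tcomp_inj => j.
rewrite tcomp_DRot !FbarE mulr_sumr; apply: eq_bigr => alpha res.
by rewrite (resonant_monomial_Rot _ _ _ _ _ _ _ res) mulrCA.
Qed.

(** Multiplication by [i omega0] commutes with the rotation of [z]; the other two components are
    constant and fixed by [DRot]. *)
Lemma L0_Rot_equivariant (R : realType) (omega0 Omega0 : R) :
  Rot_equivariant omega0 Omega0 (L0 omega0 Omega0).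
Proof. by move=> [[z psi] w] theta /=; rewrite mulrCA. Qed.

Lemma DRotD (R : realType) (omega0 theta : R) u :
  {morph DRot omega0 theta u : V W / V + W}.
Proof.
move=> [[a b] c] [[a' b'] c'].
by congr (_, _, _); exact: mulrDr.
Qed.

Lemma DRot_tscale (R : realType) (omega0 theta r : R) u V :
  DRot omega0 theta u (tscale r V) = tscale r (DRot omega0 theta u V).
Proof. by case: V => [[a b] c] /=; rewrite mulrCA. Qed.

Theorem theorem5p5 (R : realType) (omega0 Omega0 eps : R)
    (omega0_gt0 : 0 < omega0) (Omega0_neq0 : Omega0 != 0)
    (ratio_rat : exists q : rat, omega0 / Omega0 = ratr q)
    (eps_gt0 : 0 < eps) (eps_lt1 : eps < 1)
    (F Fbar : vector_field R)
    (F_expansion : has_finite_ft_expansion F)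
    (Fbar_projection : resonant_projection omega0 Omega0 F Fbar) :
  Rot_equivariant omega0 Omega0 (normal_form omega0 Omega0 eps Fbar).
Proof.
(* Each field at the rotated point becomes [DRot] of its value at [u], so linearity of [DRot] is all
   that remains. *)
move=> u theta; rewrite /normal_form -L0_Rot_equivariant.
rewrite -(resonant_projection_Rot_equivariant _ _ _ _ _ Fbar_projection).
by rewrite -DRot_tscale; exact: DRotD.
Qed.
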